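(* Let $d=(d_1,\ldots,d_n)$ be a non-increasing sequence of positive integers such that $d_1\geq 2$ and $\sum_{i=1}^n d_i=2n-2c$ for some positive integer $c$. Then $$ \alpha_{\min}^{\mathcal F}(d)= \begin{cases} n_1(d)-c+1, & \text{if } n_1(d)>n_{\geq 2}(d) \text{ and } c-1<\left\lceil\frac{n_1(d)-n_{\geq 2}(d)}{2}\right\rceil,\\[2mm] \left\lceil\frac{n}{2}\right\rceil, & \text{otherwise.} \end{cases} $$
   Context: All graphs are finite, simple and undirected. For a sequence $d$ of non-negative integers, $\mathcal F(d)$ denotes the set of all forests whose degree sequence is $d$, and $\alpha_{\min}^{\mathcal F}(d)=\min\{\alpha(F):F\in\mathcal F(d)\}$, where $\alpha(F)$ is the independence number of $F$ (the maximum cardinality of a set of pairwise non-adjacent vertices). For an integer $i\ge 0$, $n_i(d)$ and $n_{\geq i}(d)$ denote the number of entries of $d$ equal to $i$ and at least $i$, respectively. (A sequence of positive integers with sum $2n-2c$, $c\ge1$, is the degree sequence of a forest, and every such forest has exactly $c$ components.) *)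

(* Defs.v *)
From mathcomp Require Import all_boot.

Set Implicit Arguments.
Unset Strict Implicit.
Unset Printing Implicit Defensive.

Record sgraph := SGraph {
  vertex :> finType;
  adj : rel vertex;
  adj_sym : symmetric adj;
  adj_irrefl : irreflexive adj }.

Definition degree (G : sgraph) (x : G) : nat := #|[set y | adj x y]|.

(* The entries of [d] are matched with the vertices in some order, so [d] is
   taken up to permutation. *)
Definition has_degree_seq (G : sgraph) (d : seq nat) : bool :=
  perm_eq [seq degree x | x <- enum G] d.

(* For a symmetric irreflexive relation, the [ucycle]s of length at least 3 are
   exactly the graph cycles; those of length at most 2 are the empty sequence
   and the edges traversed back and forth. *)
Definition forest (G : sgraph) : Prop :=
  forall p : seq G, 2 < size p -> ~ ucycle (@adj G) p.

Definition independent (G : sgraph) (S : {set G}) : bool :=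
  [forall x in S, forall y in S, ~~ adj x y].

Definition alpha (G : sgraph) : nat :=
  \max_(S : {set G} | independent S) #|S|.

Definition in_forests (d : seq nat) (G : sgraph) : Prop :=
  forest G /\ has_degree_seq G d.

(* [m] is the minimum of [alpha] over the forests with degree sequence [d]; in
   particular there is such a forest. *)
Definition is_alpha_min_forest (d : seq nat) (m : nat) : Prop :=
  (exists2 G, in_forests d G & alpha G = m) /\
  (forall G, in_forests d G -> m <= alpha G).

Definition n_eq (i : nat) (d : seq nat) : nat := count (fun k => k == i) d.

Definition n_geq (i : nat) (d : seq nat) : nat := count (fun k => i <= k) d.

(* Main.v *)
Require Import Defs.
From mathcomp Require Import all_boot.
From mathcomp Require Import zify.

(* The value is the maximum of [n_eq 1 d - c + 1] and the ceiling of [n / 2].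
   Lower bound: a forest is bipartite, and its leaves are independent up to the
   components with two vertices, of which there are at most [c - 1].
   Upper bound: a graph with a matching [M] satisfies [alpha <= n - #|M|]. Start
   from [c] single edges, [c - 1] of them in [M], and create the vertices of
   degree [b >= 2], largest first, by attaching [b - 1] new leaves to a leaf left
   uncovered by [M], matching it with one of them. When [M] is already perfect,
   only degrees 2 remain, and [M] will miss at most one vertex. *)

(** * Independent sets in forests: the two lower bounds *)

Lemma independentP (G : sgraph) (S : {set G}) :
  reflect {in S &, forall x y, ~~ adj x y} (independent S).
Proof.
apply: (iffP forall_inP) => [h x y xS yS|h x xS].
  by move/forall_inP: (h x xS); apply.
by apply/forall_inP => y yS; apply: h.
Qed.

Lemma alpha_ge (G : sgraph) (S : {set G}) : independent S -> #|S| <= alpha G.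
Proof. exact: (@leq_bigmax_cond _ _ (fun S : {set G} => #|S|)). Qed.

(* Otherwise every path inside [A] can be prolonged: a neighbour of its first
   vertex that lies on the path, other than the second vertex, closes a cycle. *)
Lemma forest_leaf (G : sgraph) (A : {set G}) :
  forest G -> A != set0 ->
  exists2 v, v \in A & #|[set y in A | adj v y]| <= 1.
Proof.
move=> fG /set0Pn [a aA].
case: (pickP [pred v in A | #|[set y in A | adj v y]| <= 1]) => [v|noleaf].
  by case/andP=> vA v1; exists v.
suff long k : exists x p, [/\ size p = k, uniq (x :: p), path (@adj G) x p
    & {subset x :: p <= A}].
  have [x [p [sp up _ _]]] := long #|G|.
  by have := uniq_leq_size up (fun y _ => mem_enum G y); rewrite -cardT /= sp ltnn.
elim: k => [|k [x [p [sp up pp pA]]]].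
  by exists a, [::]; split=> // y; rewrite inE => /eqP ->.
have xA : x \in A by apply: pA; rewrite mem_head.
have := noleaf x; rewrite /= xA /= => /negbT; rewrite -ltnNge => deg2.
have [y /andP [yN ynp]|sub] :=
    pickP [pred y in [set y in A | adj x y] | y \notin x :: p].
  move: yN; rewrite inE => /andP [yA xy].
  exists y, (x :: p); split; first by rewrite /= sp.
  - by rewrite cons_uniq ynp.
  - by rewrite /= adj_sym xy.
  - by move=> z; rewrite inE => /orP [/eqP -> //|]; apply: pA.
have {}sub y : y \in A -> adj x y -> y \in p.
  move=> yA xy; move/(_ y)/negbT: sub; rewrite /= !inE yA xy /= negbK.
  by case/orP => // /eqP yx; rewrite yx adj_irrefl in xy.
have [y [yA xy yp ynz]] : exists y, [/\ y \in A, adj x y, y \in p & y != head x p].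
  have /card_gt1P [y [z [+ + yz]]] := deg2.
  rewrite !inE => /andP [yA xy] /andP [zA xz].
  have [yh|yh] := eqVneq y (head x p); last by exists y; split=> //; apply: sub.
  by exists z; split=> //; [apply: sub | rewrite -yh eq_sym].
case: p => // z q in sp up pp pA sub yp ynz.
move: yp; rewrite inE (negPf ynz) /= => yq.
move: up pp {sp pA sub ynz}; case/splitPr: q / yq => q1 q2 up pp.
(* As [y] differs from [z], the segment of the path from [x] to [y] has at least three vertices, and
   the edge from [y] to [x] closes it. *)
case: (fG (x :: z :: rcons q1 y)); first by rewrite /= size_rcons.
move: up pp; rewrite /ucycle /= -cat_rcons.
rewrite rcons_path cat_path last_rcons !inE !mem_cat cat_uniq !negb_or.
by move=> /and3P [/and3P [-> -> _] /andP [-> _] /and3P [-> _ _]] /and3P [-> -> _];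
  rewrite adj_sym xy.
Qed.

(** Greedy choice: pick a vertex with at most one neighbour in [A], discard both, and recurse; each
    chosen vertex uses up at most two vertices of [A]. *)
Lemma forest_indep_half (G : sgraph) (A : {set G}) :
  forest G -> exists S : {set G}, [/\ S \subset A, independent S & #|A| <= 2 * #|S|].
Proof.
move=> fG; have [n] := ubnP #|A|; elim: n A => // n IHn A ltAn.
have [->|A0] := eqVneq A set0.
  by exists set0; rewrite sub0set cards0; split=> //;
    apply/independentP => x; rewrite inE.
have [v vA degv] := forest_leaf G A fG A0.
set N := [set y in A | adj v y] in degv.
have cardA : #|A :\ v| = #|A|.-1 by rewrite (cardsD1 v A) vA.
have Apos : 0 < #|A| by rewrite card_gt0.
have cardN : #|A :\ v :\: N| + 2 >= #|A|.
  have := cardsID N (A :\ v); have := subset_leq_card (subsetIr (A :\ v) N); lia.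
have [|S [SA /independentP Sind cardS]] := IHn (A :\ v :\: N).
  have := subset_leq_card (subsetDl (A :\ v) N); lia.
have SP y : y \in S -> [/\ y != v, y \in A & ~~ adj v y].
  move/(subsetP SA); rewrite !inE => /andP [+ /andP [-> yA]].
  by rewrite yA.
exists (v |: S); split.
- by apply/subsetP => y; rewrite !inE => /orP [/eqP -> //|/SP []].
- apply/independentP => x y; rewrite !inE.
  case/orP => [/eqP ->|xS] /orP [/eqP ->|yS].
  + by rewrite adj_irrefl.
  + by case: (SP y yS).
  + by rewrite adj_sym; case: (SP x xS).
  + exact: Sind.
- have vS : v \notin S by apply/negP => /SP []; rewrite eqxx.
  by rewrite cardsU1 vS; lia.
Qed.

(** The subgraph induced on [A] has at most [#|A| - 1] edges: deleting a vertex with at most one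
    neighbour in [A] loses at most one edge. *)
Lemma forest_degree_sum (G : sgraph) (A : {set G}) :
  forest G -> A != set0 ->
  \sum_(x in A) #|[set y in A | adj x y]| + 2 <= 2 * #|A|.
Proof.
move=> fG; have [n] := ubnP #|A|; elim: n A => // n IHn A ltAn A0.
have [v vA degv] := forest_leaf G A fG A0.
have cardA : #|A| = #|A :\ v|.+1 by rewrite (cardsD1 v A) vA.
have degE x : x \in A :\ v ->
    #|[set y in A | adj x y]| = adj v x + #|[set y in A :\ v | adj x y]|.
  move=> _; rewrite (cardsD1 v) inE vA adj_sym; congr (_ + _).
  by apply: eq_card => y; rewrite !inE andbA.
have nbrs : \sum_(x in A :\ v) adj v x = #|[set y in A | adj v y]|.
  rewrite -sum1_card [RHS]big_mkcond /= [LHS]big_mkcond /=; apply: eq_bigr => x _.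
  by rewrite !inE; case: eqP => [->|_]; rewrite ?adj_irrefl ?andbF //; case: (x \in A).
rewrite (big_setD1 v) //= (eq_bigr _ degE) big_split /= nbrs.
have [A'E|A'0] := eqVneq (A :\ v) set0.
  by move: nbrs; rewrite A'E !big_set0 => <-; rewrite cardA A'E cards0.
have := IHn (A :\ v) _ A'0; lia.
Qed.

Lemma sum_degree_seq (G : sgraph) d :
  has_degree_seq G d -> \sum_(x in G) degree x = sumn d.
Proof.
by move=> /perm_sumn <-; rewrite sumnE big_map big_enum.
Qed.
(* [B] is the union of the components with two vertices. Dropping it from the
   forest leaves at least one component, so [#|B| <= 2 * c - 2]; the leaves
   outside [B], together with half of [B], form an independent set. *)
Lemma alpha_ge_leaves (G : sgraph) (c : nat) :
  forest G -> (exists x : G, 1 < degree x) ->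
  \sum_(x in G) degree x + 2 * c = 2 * #|G| ->
  #|[set x : G | degree x == 1]| + 1 <= alpha G + c.
Proof.
move=> fG [x0 x0deg] sumdeg.
set B := [set x : G | (degree x == 1) && [exists y, adj x y && (degree y == 1)]].
have nbr_uniq (x y z : G) : degree x == 1 -> adj x y -> adj x z -> y = z.
  by move=> /eqP/eq_leq/card_le1_eqP h xy xz; apply: h; rewrite inE.
have B1 x : x \in B -> degree x == 1 by rewrite inE => /andP [].
have B_closed x y : x \in B -> adj x y -> y \in B.
  rewrite inE => /andP [x1 /existsP [z /andP [xz z1]]] xy.
  rewrite (nbr_uniq x y z x1 xy xz) inE z1; apply/existsP; exists x.
  by rewrite adj_sym xz x1.
have A0 : ~: B != set0.
  apply/set0Pn; exists x0; rewrite inE; apply/negP => /B1 /eqP x01.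
  by rewrite x01 in x0deg.
have sumA := forest_degree_sum G (~: B) fG A0.
(* No edge joins [B] to its complement, so degrees outside [B] do not change when [B] is dropped. *)
have degA x : x \in ~: B -> #|[set y in ~: B | adj x y]| = degree x.
  rewrite in_setC => xB; apply: eq_card => y; rewrite [LHS]in_set [RHS]in_set in_setC.
  apply: andb_idl => xy; apply: contra xB => yB.
  by apply: (B_closed y x yB); rewrite adj_sym.
rewrite (eq_bigr _ degA) in sumA.
have sumB : \sum_(x in B) degree x = #|B|.
  by rewrite -sum1_card; apply: eq_bigr => x /B1 /eqP.
have sumAB : \sum_(x in G) degree x
    = \sum_(x in B) degree x + \sum_(x in ~: B) degree x.
  rewrite (bigID (mem B)) /=; congr (_ + _); apply: eq_bigl => x //=.
  by rewrite [in RHS]inE.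
have cardAB := cardsC B.
have [S [SB /independentP Sind cardS]] := forest_indep_half G B fG.
set L := [set x | degree x == 1].
have cardL : #|L| = #|B| + #|L :\: B|.
  rewrite -(cardsID B L); congr (#|pred_of_set _| + _).
  by apply/setIidPr/subsetP => x /B1; rewrite inE.
have cardU : #|S :|: L :\: B| = #|S| + #|L :\: B|.
  rewrite cardsU setDE.
  suff -> : S :&: (L :&: ~: B) = set0 by rewrite cards0 subn0.
  apply/setP => x; rewrite !in_setI in_setC in_set0.
  by apply/and3P => -[/(subsetP SB) ->].
(* The degree sums give [#|B| <= 2 * c - 2]; with [#|B| <= 2 * #|S|], replacing [B] by [S] costs at
   most [c - 1] leaves. *)
suff /alpha_ge : independent (S :|: L :\: B) by lia.
have leafP x : x \in L :\: B -> x \notin B /\ degree x == 1.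
  by rewrite in_setD => /andP [-> ]; rewrite inE.
apply/independentP => x y /setUP [xS|/leafP [xB x1]] /setUP [yS|/leafP [yB y1]].
- exact: Sind.
- by apply: contra yB; apply: B_closed; apply: (subsetP SB).
- by apply: contra xB; rewrite adj_sym; apply: B_closed; apply: (subsetP SB).
- apply: contra xB => xy; rewrite inE x1; apply/existsP; exists y.
  by rewrite xy.
Qed.

(** * Forests given by edge lists, and matchings in them *)

Definition edge_degree (E : seq (nat * nat)) (x : nat) : nat :=
  count_mem x (unzip1 E ++ unzip2 E).

(* The edges [(x, y)] are oriented so that [x < y], and every vertex has at most
   one smaller neighbour; the largest vertex of a cycle would have two. *)
Definition oriented_forest (n : nat) (E : seq (nat * nat)) : bool :=
  all (fun e => e.1 < e.2 < n) E && uniq (unzip2 E).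

Lemma oriented_forest_lt n E e : oriented_forest n E -> e \in E -> e.1 < e.2 < n.
Proof. by case/andP => /allP h _; apply: h. Qed.

Lemma uniq_unzip2_inj (E : seq (nat * nat)) x y v :
  uniq (unzip2 E) -> (x, v) \in E -> (y, v) \in E -> x = y.
Proof.
elim: E => //= e E IHE /andP [eE uE].
rewrite !inE => /orP [/eqP xe|xE] /orP [/eqP ye|yE].
- by move: xe; rewrite -ye => -[].
- by move: eE; rewrite -xe (map_f snd yE).
- by move: eE; rewrite -ye (map_f snd xE).
- exact: IHE.
Qed.

Definition edge_adj (n : nat) (E : seq (nat * nat)) : rel 'I_n :=
  fun x y => ((x : nat, y : nat) \in E) || ((y : nat, x : nat) \in E).

Lemma edge_adj_sym n E : symmetric (edge_adj n E).
Proof. by move=> x y; rewrite /edge_adj orbC. Qed.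

Lemma edge_adj_irrefl n E : oriented_forest n E -> irreflexive (edge_adj n E).
Proof.
move=> fE x; rewrite /edge_adj orbb; apply/negP => /(oriented_forest_lt _ _ _ fE).
by rewrite /= ltnn.
Qed.

Definition edge_graph (n : nat) (E : seq (nat * nat)) (fE : oriented_forest n E) :=
  SGraph (edge_adj_sym n E) (edge_adj_irrefl n E fE).

Lemma edge_graph_forest n E (fE : oriented_forest n E) : forest (edge_graph n E fE).
Proof.
move=> p sp.
have [x0 x0p] : exists x0, x0 \in p.
  by case: p sp => // x0 p; exists x0; rewrite mem_head.
case: (@arg_maxnP _ x0 (mem p) (fun x : 'I_n => val x) x0p) => v vp vmax.
have lower (y : 'I_n) : y \in p -> edge_adj n E v y -> (y : nat, v : nat) \in E.
  move=> yp /orP [] // /(oriented_forest_lt _ _ _ fE) /= /andP [vy _].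
  by have := vmax y yp; rewrite /= leqNgt vy.
(* Rotate the cycle so that it starts at its largest vertex [v]; its second and last vertices are
   then distinct smaller neighbours of [v]. *)
have [i q pE] := rot_to vp.
rewrite -(rot_ucycle i) pE.
have qp y : y \in q -> y \in p.
  by move=> yq; rewrite -(mem_rot i) pE inE yq orbT.
have : 1 < size q by rewrite -ltnS -[(size q).+1]/(size (v :: q)) -pE size_rot.
case: q => [|y [|z q]] // in pE qp *; move=> _.
rewrite /ucycle /= rcons_path => /andP [/and4P [vy _ _ lv] /and3P [_ yzq _]].
rewrite /= (edge_adj_sym n E) in lv.
have last_q : last z q \in z :: q by apply: mem_last.
have /val_inj yl : val y = val (last z q).
  apply: (uniq_unzip2_inj E _ _ (val v)); first by case/andP: (fE).
    by apply: lower => //; apply: qp; rewrite mem_head.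
  by apply: lower => //; apply: qp; rewrite inE last_q orbT.
by rewrite yl last_q in yzq.
Qed.

Lemma sum_eq_ord n k : k < n -> \sum_(y < n) (k == y) = 1.
Proof.
move=> kn; rewrite (bigD1 (Ordinal kn)) //= eqxx big1 // => y.
by rewrite -val_eqE /= eq_sym => /negPf ->.
Qed.

(** Double counting of pairs of a neighbour and an edge. By the orientation, [E] never contains both
    [(x, y)] and [(y, x)], so no neighbour is counted twice. *)
Lemma degree_edge_graph n E (fE : oriented_forest n E) (x : edge_graph n E fE) :
  degree x = edge_degree E (x : 'I_n).
Proof.
have uE : uniq E by case/andP: (fE) => _; apply: map_uniq.
have adjE (y : 'I_n) : (edge_adj n E x y : nat)
    = \sum_(e <- E) ((e == (x : nat, y : nat)) + (e == (y : nat, x : nat))).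
  rewrite big_split /=.
  have memE a : \sum_(e <- E) (e == a) = (a \in E).
    by rewrite -count_uniq_mem // -sum1_count [RHS]big_mkcond.
  rewrite !memE /edge_adj; case: (boolP (_ \in E)) => // xyE.
  case: (boolP (_ \in E)) => // yxE.
  have := oriented_forest_lt _ _ _ fE xyE; have := oriented_forest_lt _ _ _ fE yxE.
  by move=> /= /andP [? _] /andP [? _]; lia.
rewrite /degree -sum1_card big_mkcond /=.
transitivity (\sum_(y < n) (edge_adj n E x y : nat)).
  by apply: eq_bigr => y _; rewrite inE /=; case: edge_adj.
rewrite (eq_bigr _ (fun y _ => adjE y)) exchange_big /=.
rewrite /edge_degree count_cat !count_map -!sum1_count.
rewrite [X in _ = X + _]big_mkcond [X in _ = _ + X]big_mkcond -big_split /=.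
apply: eq_big_seq => -[a b] abE.
have /= /andP [ab bn] := oriented_forest_lt _ _ _ fE abE.
rewrite big_split /=; congr (_ + _).
  under eq_bigr => y _ do rewrite xpair_eqE.
  case: eqP => _ /=; last by rewrite big1.
  exact: sum_eq_ord.
under eq_bigr => y _ do rewrite xpair_eqE andbC.
case: eqP => _ /=; last by rewrite big1.
by apply: sum_eq_ord; apply: ltn_trans bn.
Qed.

Lemma edge_graph_degrees n E (fE : oriented_forest n E) d :
  perm_eq [seq edge_degree E x | x <- iota 0 n] d ->
  has_degree_seq (edge_graph n E fE) d.
Proof.
apply: perm_trans; rewrite -val_enum_ord -map_comp.
by rewrite (eq_map (degree_edge_graph n E fE)) perm_refl.
Qed.

(* A partition of the vertices into [size M] edges and [size U] single vertices. *)
Definition matching_cover (n : nat) (E M : seq (nat * nat)) (U : seq nat) : Prop :=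
  {subset M <= E} /\ perm_eq (unzip1 M ++ unzip2 M ++ U) (iota 0 n).

(** An independent set contains at most one end of each edge of [M]. *)
Lemma alpha_le_cover n E (fE : oriented_forest n E) M U :
  matching_cover n E M U -> alpha (edge_graph n E fE) <= size M + size U.
Proof.
case=> ME permM; apply/bigmax_leqP => /= S /independentP Sind.
set s := [seq val x | x : 'I_n in S].
have sP (x : 'I_n) : (val x \in s) = (x \in S).
  by rewrite /s mem_map ?mem_enum //; apply: val_inj.
have -> : #|S| = count (mem s) (iota 0 n).
  rewrite -val_enum_ord count_map -sum1_count -sum1_card big_enum_cond /=.
  by apply: eq_bigl => x; rewrite sP.
rewrite -(permP permM) !count_cat !count_map addnA.
apply: leq_add; last exact: count_size.
rewrite -count_predUI.
rewrite [X in _ + X](eq_in_count (a2 := pred0)) ?count_pred0 ?addn0 ?count_size //.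
move=> [a b] abM /=; apply/negP => /andP [/mapP [x + ax] /mapP [y + bby]].
rewrite !mem_enum => xS yS; have /negP := Sind x y xS yS; apply.
by rewrite /= /edge_adj /= -[nat_of_ord x]ax -[nat_of_ord y]bby ME.
Qed.

(** * Growing a forest together with a matching *)

Definition attach (n l k : nat) (E : seq (nat * nat)) : seq (nat * nat) :=
  [seq (l, j) | j <- iota n k] ++ E.

Lemma map_const_nseq (T U : Type) (u : U) (s : seq T) :
  [seq u | _ <- s] = nseq (size s) u.
Proof. by elim: s => //= x s ->. Qed.

Lemma unzip1_attach n l k E : unzip1 (attach n l k E) = nseq k l ++ unzip1 E.
Proof.
rewrite /attach /unzip1 map_cat -map_comp -[k in RHS](size_iota n k) -map_const_nseq.
by [].
Qed.

Lemma unzip2_attach n l k E : unzip2 (attach n l k E) = iota n k ++ unzip2 E.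
Proof. by rewrite /attach /unzip2 map_cat -map_comp (map_id_in (f := snd \o _)). Qed.

Lemma edge_degree_attach n l k E x :
  edge_degree (attach n l k E) x
  = k * (l == x) + (n <= x < n + k) + edge_degree E x.
Proof.
rewrite /edge_degree unzip1_attach unzip2_attach !count_cat count_nseq.
rewrite (count_uniq_mem _ (iota_uniq n k)) mem_iota /=.
by rewrite [in RHS]mulnC addnACA.
Qed.

Lemma edge_degree_out n E x : oriented_forest n E -> n <= x -> edge_degree E x = 0.
Proof.
move=> fE nx; apply/count_memPn; rewrite mem_cat; apply/negP.
by case/orP => /mapP [[a b] /(oriented_forest_lt _ _ _ fE) /= ab xE];
  move: ab nx; rewrite xE; lia.
Qed.

Lemma attach_oriented n l k E :
  oriented_forest n E -> l < n -> oriented_forest (n + k) (attach n l k E).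
Proof.
move=> fE ln; case/andP: (fE) => _ uE; apply/andP; split.
  rewrite all_cat; apply/andP; split; apply/allP => e.
    by case/mapP => j; rewrite mem_iota => jn ->; rewrite /=; lia.
  by case: e => a b /(oriented_forest_lt _ _ _ fE) /=; lia.
rewrite unzip2_attach cat_uniq iota_uniq uE andbT.
apply/hasPn => j /mapP [[a b] /(oriented_forest_lt _ _ _ fE) /= ab ->].
by rewrite mem_iota; lia.
Qed.

Lemma attach_degrees n l k E D :
  oriented_forest n E -> l < n -> edge_degree E l = 1 ->
  perm_eq [seq edge_degree E x | x <- iota 0 n] (1 :: D) ->
  perm_eq [seq edge_degree (attach n l k E) x | x <- iota 0 (n + k)]
          (k.+1 :: nseq k 1 ++ D).
Proof.
move=> fE ln l1 permD.
have new : [seq edge_degree (attach n l k E) x | x <- iota n k] = nseq k 1.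
  rewrite -[k in RHS](size_iota n k) -map_const_nseq; apply/eq_in_map => x.
  rewrite mem_iota => xnk; rewrite edge_degree_attach (edge_degree_out n) //; lia.
have rest : [seq edge_degree (attach n l k E) x | x <- rem l (iota 0 n)]
    = [seq edge_degree E x | x <- rem l (iota 0 n)].
  apply/eq_in_map => x; rewrite mem_rem_uniq ?iota_uniq // inE mem_iota
    => /andP [xl xn].
  rewrite edge_degree_attach; lia.
have lE : edge_degree (attach n l k E) l = k.+1.
  rewrite edge_degree_attach l1; lia.
have /perm_to_rem perm_l : l \in iota 0 n by rewrite mem_iota.
have permD' : perm_eq [seq edge_degree E x | x <- rem l (iota 0 n)] D.
  rewrite -(perm_cons 1); apply: perm_trans permD; rewrite -[X in X :: _]l1.
  by rewrite perm_sym (perm_map (edge_degree E) perm_l).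
rewrite iotaD add0n map_cat new perm_catC.
apply: (@perm_trans _ (nseq k 1 ++ k.+1 :: D)); last first.
  exact: permEl (perm_catCA (nseq k 1) [:: k.+1] D).
rewrite perm_cat2l; apply: perm_trans (perm_map _ perm_l) _.
by rewrite /= rest lE perm_cons.
Qed.

(** The uncovered vertices are kept as leaves, so that any of them can receive the next graft. *)
Definition built (n : nat) (E M : seq (nat * nat)) (U D : seq nat) : Prop :=
  [/\ oriented_forest n E, matching_cover n E M U,
      {in U, forall x, edge_degree E x = 1}
    & perm_eq [seq edge_degree E x | x <- iota 0 n] D].

(** The first new leaf [n] is matched with [l]; the other [k] new leaves stay uncovered. *)
Lemma built_attach_uncovered n E M l U D k :
  built n E M (l :: U) (1 :: D) ->
  built (n + k.+1) (attach n l k.+1 E) ((l, n) :: M) (iota n.+1 k ++ U)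
        (k.+2 :: nseq k.+1 1 ++ D).
Proof.
case=> fE [ME permM] U1 permD.
have U_lt x : x \in l :: U -> x < n.
  move=> xU; have := perm_mem permM x; rewrite mem_iota /= => <-.
  by rewrite !mem_cat xU !orbT.
have ln : l < n by apply: U_lt; rewrite mem_head.
have lU : l \notin U.
  have := perm_uniq permM; rewrite iota_uniq !cat_uniq => /and5P [_ _ _ _].
  by case/andP.
have l1 : edge_degree E l = 1 by apply: U1; rewrite mem_head.
split; last exact: attach_degrees.
- exact: attach_oriented.
- split.
    move=> e; rewrite inE /attach mem_cat => /orP [/eqP ->|/ME ->].
      by rewrite map_f // mem_iota; lia.
    by rewrite orbT.
  rewrite iotaD add0n /=.
  apply/permP => a; have := permP permM a.
  by rewrite /= !count_cat /= !count_cat /= => <-; lia.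
- move=> x; rewrite mem_cat mem_iota edge_degree_attach => /orP [xn|xU].
    by rewrite (edge_degree_out n) //; lia.
  have xl : l != x by apply: contraNneq lU => ->.
  have := U_lt x; rewrite inE xU orbT U1 ?inE ?xU ?orbT // (negPf xl).
  by move/(_ isT); lia.
Qed.

(** Here [M] is perfect, so the single new leaf is the only uncovered vertex. *)
Lemma built_attach_covered n E M l D :
  l < n -> edge_degree E l = 1 -> built n E M [::] (1 :: D) ->
  built (n + 1) (attach n l 1 E) M [:: n] (2 :: 1 :: D).
Proof.
move=> ln l1 [fE [ME permM] _ permD].
split; last exact: (attach_degrees _ _ 1).
- exact: attach_oriented.
- split; first by move=> e /ME eE; rewrite mem_cat eE orbT.
  by rewrite iotaD add0n /= catA perm_cat2r -[X in perm_eq X]cats0 -catA.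
- move=> x; rewrite inE => /eqP ->.
  by rewrite edge_degree_attach (edge_degree_out n) //; lia.
Qed.

Lemma built_single_edges c :
  exists E M U, [/\ built (2 * c.+1) E M U (nseq (2 * c.+1) 1),
                    size M = c & size U = 2].
Proof.
elim: c => [|c [E [M [U [[fE [ME permM] U1 permD] sM sU]]]]].
  exists [:: (0, 1)], [::], [:: 0; 1]; split=> //; split=> // x.
  by rewrite !inE => /orP [] /eqP ->.
set n := 2 * c.+1 in fE ME permM permD *.
have -> : 2 * c.+2 = n.+2 by lia.
clearbody n.
have degE x : edge_degree ((n, n.+1) :: E) x = (n <= x < n.+2) + edge_degree E x.
  by rewrite /edge_degree /= !count_cat /=; lia.
exists ((n, n.+1) :: E), ((n, n.+1) :: M), U; split=> //; last by rewrite /= sM.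
split.
- case/andP: (fE) => ltE uE; apply/andP; split.
    rewrite /= !ltnS leqnn; apply/allP => -[a b] /(oriented_forest_lt _ _ _ fE) /=.
    lia.
  rewrite /= uE andbT; apply/negP => /mapP [[a b] /(oriented_forest_lt _ _ _ fE) /=].
  lia.
- split.
    by move=> e; rewrite !inE => /orP [-> //|/ME ->]; rewrite orbT.
  rewrite -[n.+2]addn2 iotaD add0n /=.
  apply/permP => a; have := permP permM a.
  by rewrite /= !count_cat /= !count_cat /= => <-; lia.
- move=> x xU; rewrite degE U1 //.
  have : x \in iota 0 n by rewrite -(perm_mem permM) !mem_cat xU !orbT.
  by rewrite mem_iota; lia.
- rewrite -[n.+2]addn2 iotaD add0n map_cat /= nseqD.
  rewrite !degE !(edge_degree_out n) // perm_cat //; last first.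
    by rewrite /= !addn0 leqnn !ltnS leqnSn leqnn.
  apply: etrans permD; congr perm_eq; apply/eq_in_map => x.
  by rewrite mem_iota degE; lia.
Qed.

Lemma built_perm n E M U D D' :
  perm_eq D D' -> built n E M U D -> built n E M U D'.
Proof. by move=> DD' [? ? ? permD]; split=> //; apply: perm_trans DD'. Qed.

Lemma double_size_le_sumn (s : seq nat) : all (leq 2) s -> 2 * size s <= sumn s.
Proof. by elim: s => //= x s IHs /andP [x2 /IHs]; lia. Qed.

(* Every new vertex [b] is grafted onto a leaf, an uncovered one as long as there
   is one. Since larger degrees come first, the uncovered leaves run out only when
   [b = 2], and from then on at most one vertex remains uncovered. *)
Lemma exists_built c bs :
  sorted leq bs -> all (leq 2) bs ->
  exists n E M U L,
    [/\ built n E M U (bs ++ nseq L 1),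
        L + 2 * size bs = 2 * c.+1 + sumn bs
      & (0 < size U /\ L = size bs + size U + 2 * c) \/
        (size U <= 1 /\ exists2 b, b \in bs & b <= 2)].
Proof.
elim: bs => [|b bs IHbs].
  (* In the first alternative the matching has [c + size bs] edges, so [size M + size U = L - c]. *)
  have [E [M [U [builtE sM sU]]]] := built_single_edges c.
  by exists (2 * c.+1), E, M, U, (2 * c.+1); split=> //; left; rewrite sU /=; lia.
move=> /= b_bs /andP [b2 bs2].
(* The head of [bs] is grafted last, after all the larger entries. *)
have b_min : all (leq b) bs by apply: order_path_min b_bs => ? ? ?; apply: leq_trans.
have [n [E [M [U [[|L] [builtD sumL casesU]]]]]] := IHbs (path_sorted b_bs) bs2.
  by have := double_size_le_sumn bs bs2; lia.
have perm1 : perm_eq (bs ++ nseq L.+1 1) (1 :: bs ++ nseq L 1).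
  exact: permEl (perm_catCA bs [:: 1] (nseq L 1)).
case: b b2 b_min {b_bs} => [|[|k]] // _ b_min.
have perm2 : perm_eq (k.+2 :: nseq k.+1 1 ++ (bs ++ nseq L 1))
                     ((k.+2 :: bs) ++ nseq (k.+1 + L) 1).
  by rewrite perm_cons nseqD; apply: permEl (perm_catCA _ _ _).
have sum2 : k.+1 + L + 2 * (size bs).+1 = 2 * c.+1 + (k.+2 + sumn bs) by lia.
have k0 : (exists2 b, b \in bs & b <= 2) -> k = 0.
  by case=> b /(allP b_min) ? ?; lia.
have {builtD} := built_perm _ _ _ _ _ _ perm1 builtD.
case: U casesU => [|l U] casesU builtD.
  have {casesU}k_eq0 : k = 0 by case: casesU => [[]|[_ /k0]].
  rewrite k_eq0 in perm2 sum2 *.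
  have [l ln l1] : exists2 l, l < n & edge_degree E l = 1.
    have : 1 \in [seq edge_degree E x | x <- iota 0 n].
      by case: builtD => _ _ _ /perm_mem ->; rewrite mem_head.
    by case/mapP => l; rewrite mem_iota => ln l1; exists l.
  have builtD' := built_attach_covered _ _ _ _ _ ln l1 builtD.
  exists (n + 1), (attach n l 1 E), M, [:: n], (1 + L); split=> //.
    exact: built_perm perm2 builtD'.
  by right; split=> //; exists 2; rewrite ?mem_head.
have builtD' := built_attach_uncovered _ _ _ _ _ _ k builtD.
exists (n + k.+1), (attach n l k.+1 E), ((l, n) :: M), (iota n.+1 k ++ U), (k.+1 + L).
split=> //; first exact: built_perm perm2 builtD'.
rewrite size_cat size_iota /=.
(* If no vertex is left uncovered, then [k = 0] and the entry just created is a 2. Otherwise the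
   first alternative persists: under the second, [l] was the only uncovered leaf and [k = 0]. *)
have [sU|sU] := posnP (k + size U); last first.
  case: casesU => [[_ /= L_eq]|[/= sU1 /k0 k_eq0]]; first by left; lia.
  by lia.
right; split; first by rewrite sU.
by exists k.+2; [rewrite mem_head | lia].
Qed.

(** * Combining the bounds *)

Lemma alpha_ge_half (G : sgraph) : forest G -> #|G| <= 2 * alpha G.
Proof.
move=> fG; have [S [_ /(alpha_ge G) Sa cardS]] := forest_indep_half G setT fG.
by move: cardS; rewrite cardsT; lia.
Qed.

Lemma has_degree_seq_card (G : sgraph) d : has_degree_seq G d -> #|G| = size d.
Proof. by move/perm_size <-; rewrite size_map cardE. Qed.

Lemma has_degree_seq_count (G : sgraph) d (a : pred nat) :
  has_degree_seq G d -> #|[set x : G | a (degree x)]| = count a d.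
Proof.
move/permP/(_ a) <-; rewrite count_map -sum1_count -sum1_card big_enum_cond.
by apply: eq_bigl => x; rewrite inE.
Qed.

(* No subtraction truncates where it matters: [0 < c], the difference
   [n_eq 1 d - n_geq 2 d] is only relevant when positive, and then
   [c <= n_eq 1 d]. [uphalf k] is the ceiling of [k / 2]. *)
Theorem theorem2 (n : nat) (d : n.-tuple nat) (c : nat)
  (d_noninc : sorted geq d)
  (d_pos : forall k, k \in d -> 0 < k)
  (d1_ge2 : 2 <= nth 0 d 0)
  (c_pos : 0 < c)
  (d_sum : \sum_(i < n) tnth d i + 2 * c = 2 * n) :
  is_alpha_min_forest d
    (if (n_geq 2 d < n_eq 1 d) && (c - 1 < uphalf (n_eq 1 d - n_geq 2 d))
     then n_eq 1 d - c + 1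
     else uphalf n).
Proof.
have sum_d : sumn d + 2 * c = 2 * n.
  by rewrite -d_sum sumnE big_tuple.
have cnt_n : n_eq 1 d + n_geq 2 d = n.
  rewrite /n_eq /n_geq -[RHS](size_tuple d) -(count_predC (fun k => 2 <= k) d) addnC.
  congr (_ + _); apply: eq_in_count => k /d_pos /=.
  lia.
have n_pos : 0 < n.
  by case: n d d1_ge2 {d_noninc d_pos d_sum sum_d cnt_n} => [d|//]; rewrite tuple0.
have d0 : nth 0 d 0 \in d by apply: mem_nth; rewrite size_tuple.
have m_pos : 0 < n_geq 2 d by rewrite -has_count; apply/hasP; exists (nth 0 d 0).
have lower G : in_forests d G -> n_eq 1 d + 1 <= alpha G + c /\ n <= 2 * alpha G.
  case=> fG dG; split; last first.
    by rewrite -(size_tuple d) -(has_degree_seq_card G d dG); apply: alpha_ge_half.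
  rewrite /n_eq -(has_degree_seq_count G d _ dG); apply: alpha_ge_leaves => //.
    have : nth 0 d 0 \in [seq degree x | x <- enum G] by rewrite (perm_mem dG).
    by case/mapP => x _ d0E; exists x; rewrite -d0E.
  by rewrite (sum_degree_seq G d dG) (has_degree_seq_card G d dG) size_tuple.
set bs := sort leq [seq k <- d | 2 <= k].
have bs_size : size bs = n_geq 2 d by rewrite size_sort size_filter.
have bs2 : all (leq 2) bs by rewrite all_sort filter_all.
have d_perm L : L = n_eq 1 d -> perm_eq (bs ++ nseq L 1) d.
  move=> ->; apply: perm_trans (permEl (perm_filterC (leq 2) d)).
  apply: perm_cat; first by rewrite perm_sort.
  rewrite (@eq_in_filter _ _ (pred1 1)); last by move=> k /d_pos /=; lia.
  by have /all_pred1P -> := filter_all (pred1 1) d; rewrite size_filter.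
have bs_sum : sumn bs + n_eq 1 d = sumn d.
  by rewrite -(perm_sumn (d_perm _ erefl)) sumn_cat sumn_nseq mul1n.
have bs_sorted : sorted leq bs by apply: sort_sorted leq_total _.
(* [exists_built] starts from one edge more than its parameter, hence [c.-1]. *)
have [n' [E [M [U [L [[fE cover _ degs] sumL casesU]]]]]] :=
  exists_built c.-1 bs bs_sorted bs2.
have L_eq : L = n_eq 1 d by lia.
have inG : in_forests d (edge_graph n' E fE).
  split; first exact: edge_graph_forest.
  by apply: edge_graph_degrees; apply: perm_trans degs (d_perm L L_eq).
have n'_eq : n' = n.
  by have := has_degree_seq_card _ _ inG.2; rewrite card_ord size_tuple.
have sizeMU : 2 * size M + size U = n'.
  have := perm_size cover.2;
  rewrite size_iota /unzip1 /unzip2 !size_cat !size_map => <-.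
  by rewrite mul2n -addnn addnA.
have upper := alpha_le_cover n' E fE M U cover.
split; last by move=> G /lower; case: ifP; lia.
exists (edge_graph n' E fE) => //.
(* The first alternative gives [size U = n_eq 1 d - n_geq 2 d - 2 * (c - 1)], which is positive
   exactly under the condition of the [if], and [alpha] is at most [n_eq 1 d - c + 1]. The second
   gives at most [uphalf n]. The lower bounds settle both cases. *)
have := lower _ inG; case: ifP; lia.
Qed.
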